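(* Let $G$ and $H$ be graphs and let $k,\ell$ be positive integers. Then $$\left\lceil \frac{\Delta(G)\Delta(H)+\Delta(G)+\Delta(H)}{2}\right\rceil\leq {\rm la}_{\max\{k,\ell\}}(G\boxtimes H)\leq {\rm la}_{k}(G)+{\rm la}_{\ell}(H)+2\,{\rm la}_{k}(G)\,{\rm la}_{\ell}(H).$$ Moreover, the bounds are sharp.
   Context: All graphs are finite, simple and undirected; $\Delta(G)$ denotes the maximum degree. A linear $k$-forest is a forest each of whose components is a path of length (number of edges) at most $k$. The linear $k$-arboricity ${\rm la}_k(G)$ of a graph $G$ is the least number of linear $k$-forests (subgraphs of $G$) whose edge sets partition $E(G)$. The strong product $G\boxtimes H$ has vertex set $V(G)\times V(H)$, with $(u,v)$ adjacent to $(u',v')$ iff ($uu'\in E(G)$ and $v=v'$), or ($u=u'$ and $vv'\in E(H)$), or ($uu'\in E(G)$ and $vv'\in E(H)$). *)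

(* Defs.v *)
From mathcomp Require Import all_boot.

Set Implicit Arguments.
Unset Strict Implicit.
Unset Printing Implicit Defensive.

Record sgraph := SGraph {
  svertex :> finType;
  adj : rel svertex;
  adj_sym : symmetric adj;
  adj_irr : irreflexive adj }.

Definition edges (G : sgraph) : {set {set G}} :=
  [set [set p.1; p.2] | p : G * G & adj p.1 p.2].

Definition max_degree (G : sgraph) : nat := \max_(x : G) #|[set y | adj x y]|.

Section StrongProduct.
Variables G H : sgraph.

Definition strong_adj : rel (G * H) := fun p q =>
  [|| adj p.1 q.1 && (p.2 == q.2),
      (p.1 == q.1) && adj p.2 q.2
    | adj p.1 q.1 && adj p.2 q.2].

Fact strong_adj_sym : symmetric strong_adj.
Proof.
by move=> p q; rewrite /strong_adj ![adj q.1 _]adj_sym ![adj q.2 _]adj_sym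
  [q.1 == _]eq_sym [q.2 == _]eq_sym.
Qed.

Fact strong_adj_irr : irreflexive strong_adj.
Proof. by move=> p; rewrite /strong_adj !adj_irr andbF. Qed.

Definition strong_product : sgraph := SGraph strong_adj_sym strong_adj_irr.
End StrongProduct.

Section LinearForest.
Variable T : finType.
Implicit Type e : rel T.

(* A cycle is a duplicate-free cyclic sequence of at least three vertices; *)
(* it has at most #|T| of them, so bounding n loses nothing.              *)
Definition forest e : bool :=
  [forall n : 'I_#|T|.+1, forall c : n.-tuple T,
     cycle e c && uniq c ==> (n < 3)].

Definition component e (x : T) : {set T} := [set y | connect e x y].

(* The subgraph induced on C is a path with n edges (n + 1 vertices). *)
Definition is_path e (C : {set T}) (n : nat) : bool :=
  [exists f : {ffun 'I_n.+1 -> T},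
    [&& injectiveb f, f @: 'I_n.+1 == C
      & [forall i : 'I_n.+1, forall j : 'I_n.+1,
          e (f i) (f j) == ((i.+1 == j :> nat) || (j.+1 == i :> nat))]]].

Definition linear_forest (k : nat) e : bool :=
  forest e &&
  [forall x, exists n : 'I_k.+1, is_path e (component e x) n].
End LinearForest.

Section LinearArboricity.
Variables (k : nat) (G : sgraph).

(* The spanning subgraph with edge set F. The vertices that F does not cover *)
(* are isolated, i.e. components that are paths of length 0.                 *)
Definition edge_rel (F : {set {set G}}) : rel G := fun x y => [set x; y] \in F.

Definition linear_decomposition (P : {set {set {set G}}}) : bool :=
  partition P (edges G) && [forall F in P, linear_forest k (edge_rel F)].

Definition single_edges : {set {set {set G}}} := [set [set a] | a in edges G].

(* For 0 < k the partition of the edges into single edges is a linear      *)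
(* decomposition, so that the minimum is attained (linear_arboricityP). For *)
(* k = 0 the value is irrelevant.                                          *)
Definition linear_arboricity : nat :=
  #|[arg min_(P < single_edges | linear_decomposition P) #|P|]|.

Lemma single_edgesP : 0 < k -> linear_decomposition single_edges.
Proof.
move=> k_gt0; apply/andP; split.
  apply/and3P; split.
  - apply/eqP/setP=> a; apply/bigcupP/idP => [[_ /imsetP[b bE ->]]|aE].
      by rewrite inE => /eqP->.
    by exists [set a]; rewrite ?set11 //; apply: imset_f.
  - apply/trivIsetP=> _ _ /imsetP[a _ ->] /imsetP[b _ ->] neq.
    rewrite disjoints1 inE; apply: contraNneq neq => ->; exact: eqxx.
  - by apply/imsetP=> -[a _ /setP/(_ a)]; rewrite !inE eqxx.
apply/'forall_implyP=> _ /imsetP[_ /imsetP[[u v] /= uv ->] ->].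
rewrite inE /= in uv; set e := edge_rel _.
have neq_uv : u != v by apply: contraTneq uv => ->; rewrite adj_irr.
have eE x y : e x y = (x == u) && (y == v) || (x == v) && (y == u).
  rewrite /e /edge_rel inE; apply/eqP/orP=> [/setP eq|]; last first.
    by case=> /andP[/eqP-> /eqP->] //; rewrite setUC.
  have := eq y; have := eq x; have := eq v; have := eq u.
  rewrite !inE !eqxx !orbT /= => eu ev /esym/orP[]/eqP ? /esym/orP[]/eqP ?;
    subst x y; rewrite ?eqxx; try (by left); try (by right).
  - by rewrite eq_sym (negPf neq_uv) in ev.
  - by rewrite (negPf neq_uv) in eu.
apply/andP; split.
  apply/forallP=> -[n ltn]; apply/forallP=> -[c /= /eqP sz_c]; apply/implyP.
  rewrite ltnNge -sz_c; case: c {sz_c} => [|a [|b [|d c]]] //= /andP[].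
  rewrite !eE !inE => /and3P[ab bd _] /and3P[/norP[_ /norP[ad _]] _ _].
  move: bd ad; case/orP: ab => /andP[/eqP-> /eqP->]; rewrite !eqxx.
    by rewrite eq_sym (negPf neq_uv) /= => /eqP->; rewrite eqxx.
  by rewrite (negPf neq_uv) /= orbF => /eqP->; rewrite eqxx.
have step x y : e x y -> (x \in [set u; v]) && (y \in [set u; v]).
  by rewrite eE !inE => /orP[]/andP[-> ->]; rewrite ?orbT.
have walk p x : x \in [set u; v] -> path e x p -> last x p \in [set u; v].
  elim: p x => //= y p IHp x _ /andP[/step/andP[_ yuv]]; exact: IHp.
apply/forallP=> x; have [xuv|xuv] := boolP (x \in [set u; v]).
  have k1 : 1 < k.+1 by [].
  apply/existsP; exists (Ordinal k1); apply/existsP.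
  exists [ffun i : 'I_2 => if i == 0 :> nat then u else v].
  apply/and3P; split.
  - apply/injectiveP=> -[[|[|?]] ?] -[[|[|?]] ?] //; rewrite !ffunE /= => eq;
      apply: val_inj => //=; by rewrite eq eqxx in neq_uv.
  - apply/eqP/setP=> y; rewrite [RHS]inE; apply/imsetP/idP => [[i _ ->]|].
      have inuv : connect e u v by apply: connect1; rewrite eE !eqxx.
      have invu : connect e v u by apply: connect1; rewrite eE !eqxx orbT.
      by rewrite ffunE; move: xuv; rewrite !inE => /orP[]/eqP->; case: ifP.
    case/connectP=> p pth ->; have := walk p x xuv pth.
    rewrite !inE => /orP[]/eqP->; [exists ord0 | exists ord_max] => //;
      by rewrite ffunE.
  - apply/forallP=> -[[|[|?]] ?] //; apply/forallP=> -[[|[|?]] ?] //;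
    by rewrite !ffunE /= eE !eqxx ?(negPf neq_uv) ?[v == u]eq_sym ?(negPf neq_uv).
apply/existsP; exists ord0; apply/existsP; exists [ffun=> x].
apply/and3P; split.
- by apply/injectiveP=> i j _; rewrite (ord1 i) (ord1 j).
- apply/eqP/setP=> y; rewrite [RHS]inE; apply/imsetP/idP => [[i _ ->]|].
    by rewrite ffunE.
  case/connectP=> -[_ ->|z p /= /andP[/step]]; last by rewrite (negPf xuv).
  by exists ord0; rewrite ?ffunE.
- apply/forallP=> i; apply/forallP=> j; rewrite !ffunE (ord1 i) (ord1 j) /=.
  by apply/eqP/negbTE; apply: contra xuv => /step/andP[].
Qed.

Lemma linear_arboricityP : 0 < k ->
  (exists2 P, linear_decomposition P & #|P| = linear_arboricity) /\
  (forall P, linear_decomposition P -> linear_arboricity <= #|P|).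
Proof.
move=> k_gt0; rewrite /linear_arboricity.
case: arg_minnP => [|P decP minP]; first exact: single_edgesP.
by split=> //; exists P.
Qed.
End LinearArboricity.

(* Main.v *)
(** A linear k-forest is the same thing as a partial injection [d] together with
    a rank [r <= k] that grows by one along [d]: the orbits of [d] are the paths.
    Such orientations are stable under taking subrelations, so the linear
    k-arboricity is the least size of a cover of the edges by orientations.
    If [d1] and [d2] orient forests of [G] and [H], then the four relations
    [d1 x =], [= x d2], [d1 x d2] and [d1 x d2^-1] are orientations of forests
    of the strong product; this gives the upper bound. The lower bound holds
    because an orientation contributes at most two neighbours to each vertex.
    Both bounds are equal to 4 when [G] and [H] are the path with two edges
    and [k = l = 2]. *)

Require Import Defs.
From mathcomp Require Import all_boot.

Set Implicit Arguments.
Unset Strict Implicit.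
Unset Printing Implicit Defensive.

(** * Linear forests as ranked partial injections *)

Section Orientation.
Variables (T : finType) (k : nat).

(** The rank rules out directed cycles and at the same time bounds the length of every path by
    [k]. *)
Record linear_orientation (d : rel T) (r : T -> nat) : Prop := {
  orient_fun : forall x y z, d x y -> d x z -> y = z;
  orient_inj : forall x y z, d x z -> d y z -> x = y;
  orient_step : forall x y, d x y -> r y = (r x).+1;
  orient_rank : forall x, r x <= k }.

Definition sym_closure (d : rel T) : rel T := fun x y => d x y || d y x.

Lemma sym_closure_sym d : symmetric (sym_closure d).
Proof. by move=> x y; rewrite /sym_closure orbC. Qed.

Lemma sub_linear_orientation d d' r :
  subrel d' d -> linear_orientation d r -> linear_orientation d' r.
Proof.
move=> sub [df di ds dr]; split=> // [x y z /sub xy /sub|x y z /sub xz /sub|x y /sub].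
- exact: df.
- exact: di.
- exact: ds.
Qed.

Lemma eq_linear_forest (e e' : rel T) :
  e =2 e' -> linear_forest k e = linear_forest k e'.
Proof.
move=> ee; congr (_ && _).
  by apply: eq_forallb => n; apply: eq_forallb => c; rewrite (eq_cycle ee).
apply: eq_forallb => x; apply: eq_existsb => n.
have -> : component e x = component e' x.
  by apply/setP=> y; rewrite !inE (eq_connect ee).
apply: eq_existsb => f; congr [&& _, _ & _].
by apply: eq_forallb => i; apply: eq_forallb => j; rewrite ee.
Qed.

(* At a vertex of maximal rank on a cycle both neighbours are predecessors. *)
Lemma orientation_forest d r : linear_orientation d r -> forest (sym_closure d).
Proof.
move=> [_ di ds _]; apply/forallP=> n; apply/forallP=> c; apply/implyP=> /andP[cyc uc].
rewrite -(size_tuple c) ltnNge; apply/negP=> sz_c.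
have [x0 x0c] : {x0 | x0 \in tval c}.
  by case: (tval c) sz_c => [|a s] // _; exists a; rewrite mem_head.
case: (@arg_maxnP _ x0 (mem c) r x0c) => x xc xmax.
have [i s def_c] := rot_to xc.
move: cyc uc sz_c; rewrite -(rot_cycle i) -(rot_uniq i) -(size_rot i) def_c.
have {}xmax y : y \in s -> r y <= r x.
  by move=> ys; apply: xmax; rewrite /= -(mem_rot i) def_c inE ys orbT.
have pred y : y \in s -> sym_closure d x y -> d y x.
  by move=> /xmax le /orP[/ds eq|//]; rewrite eq ltnn in le.
case: s def_c xmax pred => [|b s] _ //= _ pred /andP[xb].
rewrite rcons_path => /andP[_]; rewrite sym_closure_sym => xl /and3P[_ bs _] sz_s.
have dbx := pred _ (mem_head _ _) xb; have dlx := pred _ (mem_last _ _) xl.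
(* Injectivity identifies the two neighbours of [x], yet they are distinct entries of a
   duplicate-free cycle of length at least three. *)
move: bs; rewrite (di _ _ _ dbx dlx).
by case: s sz_s {xl dlx pred} => //= z s _; rewrite mem_last.
Qed.

(** The path starts at a vertex of minimal rank in the component and follows [d] as long as
    possible. It fills the component: an edge at one of its vertices runs along or against [d], so
    it leads back into the path. *)
Lemma orientation_is_path d r x : linear_orientation d r ->
  [exists n : 'I_k.+1, is_path (sym_closure d) (component (sym_closure d) x) n].
Proof.
move=> [df di ds dr]; set e := sym_closure d.
have csym : connect_sym e by apply: sym_connect_sym (sym_closure_sym d).
case: (@arg_minnP _ x (connect e x) r (connect0 _ _)) => x0 xx0 x0min.
(* By default [s] stays put where there is no successor; the walk is used only up to the first such
   vertex. *)
pose s y := odflt y [pick z | d y z]; pose f i := iter i s x0.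
pose stuck i := [pick z | d (f i) z] == None.
have step i : ~~ stuck i -> d (f i) (f i.+1).
  by rewrite /stuck /f iterS /s; case: pickP.
have rank i : (forall j, j < i -> ~~ stuck j) -> r (f i) = r x0 + i.
  elim: i => [|i IHi] ns; first by rewrite addn0.
  rewrite (ds _ _ (step _ (ns _ (ltnSn _)))) IHi ?addnS // => j ji.
  exact: ns (ltnW ji).
have ex_stuck : exists i, stuck i.
  case: (boolP [exists i : 'I_k.+1, stuck i]) => [/existsP[i si]|]; first by exists i.
  (* After [k.+1] genuine steps the rank would exceed [k]. *)
  move/existsPn=> ns; have := dr (f k.+1); rewrite rank ?addnS; last first.
    by move=> j jk; exact: (ns (Ordinal jk)).
  by rewrite ltnNge leq_addl.
case: (ex_minnP ex_stuck) => n sn nmin.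
have ns j : j < n -> ~~ stuck j by rewrite ltnNge; apply/contra/nmin.
have rankn i : i <= n -> r (f i) = r x0 + i.
  by move=> le_in; apply: rank => j ji; apply: ns (leq_trans ji le_in).
have nk : n < k.+1 by rewrite ltnS (leq_trans _ (dr (f n))) // rankn ?leq_addl.
have conn i : i <= n -> connect e x0 (f i).
  elim: i => [|i IHi] ltin; first exact: connect0.
  by apply: connect_trans (IHi (ltnW ltin)) (connect1 _); rewrite /e /sym_closure step ?ns.
apply/existsP; exists (Ordinal nk); apply/existsP; exists [ffun i : 'I_n.+1 => f i].
apply/and3P; split.
- apply/injectiveP=> i j; rewrite !ffunE => /(congr1 r).
  by rewrite !rankn -1?ltnS ?ltn_ord // => /addnI/val_inj.
- apply/eqP/setP=> y; rewrite [RHS]inE (same_connect csym xx0).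
  apply/imsetP/idP=> [[i _ ->]|x0y]; first by rewrite ffunE conn // -ltnS.
  suff [i le_in ->] : exists2 i, i <= n & y = f i.
    have ltin : i < n.+1 by [].
    by exists (Ordinal ltin); rewrite ?ffunE.
  case/connectP: x0y => p; elim/last_ind: p y => [|p z IHp] y /=.
    by move=> _ ->; exists 0.
  rewrite rcons_path last_rcons => /andP[pth lz] ->.
  have [i le_in fi] := IHp _ pth erefl; rewrite fi in lz.
  case/orP: lz => [dz|dz].
    have ltin : i < n.
      rewrite ltn_neqAle le_in andbT; apply: contraTneq sn => <-.
      by rewrite /stuck; case: pickP => // /(_ z); rewrite dz.
    by exists i.+1 => //; apply: df dz (step _ (ns _ ltin)).
  (* A step back from [x0] would reach a smaller rank within the component. *)
  case: i le_in fi dz => [|i] ltin fi dz.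
    suff /x0min : connect e x z by rewrite (ds _ _ dz) ltnn.
    by rewrite (connect_trans xx0) // connect1 // /e /sym_closure dz orbT.
  by exists i; [exact: ltnW | exact: di dz (step _ (ns _ ltin))].
- apply/forallP=> i; apply/forallP=> j; rewrite !ffunE.
  have dE (a b : 'I_n.+1) : d (f a) (f b) = (a.+1 == b :> nat).
    apply/idP/eqP=> [/ds|ab].
      by rewrite !rankn -1?ltnS ?ltn_ord // -addnS => /addnI.
    by rewrite -ab step // ns // -ltnS ab.
  by rewrite /e /sym_closure !dE.
Qed.

Lemma orientation_linear_forest d r :
  linear_orientation d r -> linear_forest k (sym_closure d).
Proof.
move=> dr; apply/andP; split; first exact: orientation_forest dr.
by apply/forallP=> x; apply: orientation_is_path dr.
Qed.

(** The rank of a vertex is its position along the path of its component; every edge joins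
    consecutive positions and is oriented upwards. *)
Lemma linear_forest_orientation (e : rel T) : symmetric e -> linear_forest k e ->
  exists d r, linear_orientation d r /\ e =2 sym_closure d.
Proof.
move=> e_sym /andP[_ /forallP pathP].
have csym : connect_sym e by apply: sym_connect_sym.
have /fin_all_exists[walk walkP] x : exists s : seq T, [/\ size s <= k.+1, s =i component e x &
    {in s &, forall y z, e y z ->
      (index y s).+1 = index z s \/ (index z s).+1 = index y s}].
  have /existsP[n /existsP[f]] := pathP x.
  case/and3P=> /injectiveP f_inj /eqP imf /forallP ef.
  have uf : uniq (codom f) by exact/injectiveP.
  have indexf i : index (f i) (codom f) = i.
    by rewrite codomE index_map // index_enum_ord.
  exists (codom f); split.
  - by rewrite size_codom card_ord.
  - by move=> y; rewrite -imf; apply/codomP/imsetP=> [[i ->]|[i _ ->]]; exists i.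
  move=> _ _ /codomP[i ->] /codomP[j ->]; rewrite !indexf.
  have /forallP/(_ j)/eqP-> := ef i.
  by case/orP=> /eqP; [left|right].
(* Going through [root] makes all vertices of a component share one enumeration. *)
pose r x := index x (walk (root e x)).
have mem_walk x : x \in walk (root e x).
  have [_ -> _] := walkP (root e x); rewrite inE csym; exact: connect_root.
have root_eq x y : e x y -> root e x = root e y.
  by move=> xy; apply/eqP; rewrite root_connect // connect1.
have r_inj x y : root e x = root e y -> r x = r y -> x = y.
  rewrite /r => eq; have := mem_walk x; have := mem_walk y; rewrite eq.
  move: (walk _) => s ys xs eqi.
  by rewrite -(nth_index x xs) eqi nth_index.
exists (fun x y => e x y && (r y == (r x).+1)), r; split; first split.
- move=> x y z /andP[xy /eqP ry] /andP[xz /eqP rz].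
  by apply: r_inj; rewrite -?(root_eq x) // ry.
- move=> x y z /andP[xz /eqP ry] /andP[yz /eqP rz].
  by apply: r_inj; [rewrite (root_eq _ _ xz) (root_eq _ _ yz)|apply: succn_inj; rewrite -ry].
- by move=> x y /andP[_ /eqP].
- move=> x; rewrite -ltnS /r; have := mem_walk x.
  have [sz _ _] := walkP (root e x) => xs; apply: leq_trans sz.
  by rewrite index_mem.
move=> x y; rewrite /sym_closure [e y x]e_sym.
case: (boolP (e x y)) => //= xy; apply/esym.
have := mem_walk x; have := mem_walk y; rewrite /r -(root_eq _ _ xy).
have [_ _ es] := walkP (root e x) => ys xs.
by case: (es _ _ xs ys xy) => ->; rewrite eqxx ?orbT.
Qed.
End Orientation.

(** * Covers by orientations, arboricity and maximum degree *)

Section Cover.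
Variable k : nat.

(* The relations may overlap and need not be contained in the adjacency. *)
Definition linear_cover (I : finType) (G : sgraph) (d : I -> rel G)
    (r : I -> G -> nat) : Prop :=
  (forall i, linear_orientation k (d i) (r i)) /\
  (forall x y, adj x y -> exists i, sym_closure (d i) x y).

Lemma mem_edges (G : sgraph) (x y : G) : ([set x; y] \in edges G) = adj x y.
Proof.
apply/imsetP/idP=> [[[u v]]|xy]; last by exists (x, y); rewrite ?inE.
rewrite inE /= => uv /setP eq.
have xuv := eq x; have yuv := eq y; have uxy := eq u; have vxy := eq v.
have neq : u != v by apply: contraTneq uv => ->; rewrite adj_irr.
move: xuv yuv uxy vxy; rewrite !inE !eqxx !orbT.
move=> /esym/orP[]/eqP-> /esym/orP[]/eqP->; rewrite ?uv // 1?adj_sym ?uv //.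
- by rewrite orbb [v == u]eq_sym (negPf neq).
- by rewrite orbb (negPf neq).
Qed.

(** Overlaps disappear once each edge is coloured by a single index that covers it; a subrelation of
    [d i] then orients the class of colour [i]. *)
Lemma linear_cover_arboricity (I : finType) (G : sgraph) (d : I -> rel G) r :
  0 < k -> linear_cover d r -> linear_arboricity k G <= #|I|.
Proof.
move=> k_gt0 [dor dcov].
pose inc i (A : {set G}) := [exists x, exists y, (A == [set x; y]) && d i x y].
pose col A := [pick i | inc i A].
have incE i x y : inc i [set x; y] -> sym_closure (d i) x y.
  case/existsP=> u /existsP[v /andP[/eqP eq duv]].
  have neq : u != v.
    by apply: contraTneq duv => ->; apply/negP=> /(orient_step (dor i))/eqP; rewrite ltn_eqF.
  have eqs := fun z => congr1 (fun A : {set G} => z \in A) eq.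
  move: (eqs x) (eqs y) (eqs u) (eqs v); rewrite !inE !eqxx !orbT.
  move=> /esym/orP[]/eqP-> /esym/orP[]/eqP->; rewrite /sym_closure ?duv ?orbT //.
  - by rewrite orbb [v == u]eq_sym (negPf neq).
  - by rewrite orbb (negPf neq).
have colP A : A \in edges G -> exists2 i, col A = Some i & inc i A.
  rewrite /col; case: pickP => [i ? _|no]; first by exists i.
  case/imsetP=> -[x y]; rewrite inE /= => /dcov[i /orP dxy] defA.
  suff: inc i A by rewrite no.
  apply/existsP; case: dxy => dxy; [exists x|exists y]; apply/existsP;
    [exists y|exists x]; by rewrite defA dxy ?andbT // setUC.
have [_ /(_ (preim_partition col (edges G)))] := linear_arboricityP G k_gt0.
set P := preim_partition _ _ => min.
have PE : P = [set [set B in edges G | c == col B] | c in col @: edges G].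
  by rewrite -imset_comp.
apply: leq_trans (min _) _; last first.
  rewrite PE; apply: leq_trans (leq_imset_card _ _) _.
  (* No edge has colour [None], so there are at most [#|I|] classes rather than one more. *)
  have /subset_leq_card : col @: edges G \subset Some @: [set: I].
    by apply/subsetP=> _ /imsetP[A /colP[i -> _] ->]; apply: imset_f.
  by move/leq_trans; apply; rewrite (leq_trans (leq_imset_card _ _)) ?cardsT.
apply/andP; split; first exact: preim_partitionP.
apply/'forall_implyP=> F; rewrite PE => /imsetP[_ /imsetP[A /colP[i -> _] ->] ->].
set B := [set _ in _ | _].
(* Restricting [d i] to [B] loses no edge of [B], since colour [i] goes only to edges that [d i]
   covers. *)
pose d' x y := d i x y && edge_rel B x y.
rewrite (@eq_linear_forest _ _ _ (sym_closure d')).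
  apply: (@orientation_linear_forest _ _ d' (r i)).
  by apply: sub_linear_orientation (dor i) => x y /andP[].
move=> x y; rewrite /sym_closure /d' /edge_rel [[set y; x]]setUC -andb_orl.
case: (boolP (_ \in B)) => [|_]; last by rewrite andbF.
rewrite andbT inE => /andP[/colP[j -> /incE]].
by move=> dxy /eqP[eq]; rewrite eq.
Qed.

Lemma arboricity_linear_cover (G : sgraph) : 0 < k ->
  exists (d : 'I_(linear_arboricity k G) -> rel G) r, linear_cover d r.
Proof.
move=> k_gt0.
have [[P /andP[partP /forallP forestP] <-] _] := linear_arboricityP G k_gt0.
have orP (i : 'I_#|P|) : exists dr : rel G * (G -> nat),
    linear_orientation k dr.1 dr.2 /\ edge_rel (enum_val i) =2 sym_closure dr.1.
  have /implyP/(_ (enum_valP i)) := forestP (enum_val i).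
  case/linear_forest_orientation => [x y|d [r dr]]; last by exists (d, r).
  by rewrite /edge_rel setUC.
have [dr drP] := fin_all_exists orP.
exists (fun i => (dr i).1), (fun i => (dr i).2); split=> [i|x y xy].
  by have [] := drP i.
have : [set x; y] \in cover P by rewrite (cover_partition partP) mem_edges.
case/bigcupP=> F FP xyF; exists (enum_rank_in FP F).
by have [_ <-] := drP (enum_rank_in FP F); rewrite /edge_rel enum_rankK_in.
Qed.

(** Each orientation gives a vertex at most one successor and one predecessor. *)
Lemma linear_cover_max_degree (I : finType) (G : sgraph) (d : I -> rel G) r :
  linear_cover d r -> max_degree G <= 2 * #|I|.
Proof.
move=> [dor dcov]; apply/bigmax_leqP=> x _.
have sub : [set y | adj x y] \subset
    \bigcup_i ([set y | d i x y] :|: [set y | d i y x]).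
  apply/subsetP=> y; rewrite inE => /dcov[i dxy].
  by apply/bigcupP; exists i; rewrite // !inE.
apply: leq_trans (subset_leq_card sub) _.
rewrite mulnC -sum_nat_const.
apply: (big_ind2 (fun (A : {set G}) m => #|A| <= m)) => [|A m B n Am Bn|i _].
- by rewrite cards0.
- exact: leq_trans (leq_card_setU _ _) (leq_add Am Bn).
apply: leq_trans (leq_card_setU _ _) _.
rewrite -[2]/(1 + 1); apply: leq_add; apply/card_le1_eqP=> y z; rewrite !inE.
- by move=> xy xz; apply: orient_fun (dor i) _ _ _ xz xy.
- by move=> yx zx; apply: orient_inj (dor i) _ _ _ zx yx.
Qed.
End Cover.

(** * Degree and arboricity of the strong product *)

Section Product.
Variables G H : sgraph.

(** The closed neighbourhood of [(u, v)] is the product of the closed neighbourhoods of [u] and [v].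
    Nonemptiness provides vertices of maximum degree: with an empty factor the right-hand side is 0
    whatever the other factor. *)
Lemma max_degree_strong_product : 0 < #|G| -> 0 < #|H| ->
  max_degree G * max_degree H + max_degree G + max_degree H
    <= max_degree (strong_product G H).
Proof.
move=> G_gt0 H_gt0.
have [u ->] : {u : G | max_degree G = #|[set y | adj u y]|} by apply: eq_bigmax.
have [v ->] : {v : H | max_degree H = #|[set y | adj v y]|} by apply: eq_bigmax.
apply: leq_trans (leq_bigmax ((u, v) : strong_product G H)).
have eqN : setX (u |: [set y | adj u y]) (v |: [set y | adj v y])
    = (u, v) |: [set y : G * H | adj ((u, v) : strong_product G H) y].
  apply/setP=> -[x y]; rewrite !inE /= /strong_adj /= xpair_eqE.
  rewrite [u == x]eq_sym [v == y]eq_sym.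
  by case: (x == u); case: (y == v); case: (adj u x); case: (adj v y).
have := congr1 (fun A : {set _} => #|A|) eqN.
rewrite cardsX !cardsU1 !inE !adj_irr !add1n mulSn mulnS.
rewrite addSn => -[<-].
by rewrite addnC [_ * _ + _]addnC.
Qed.

Variables k l : nat.
Hypotheses (k_gt0 : 0 < k) (l_gt0 : 0 < l).

Lemma strong_product_arboricity :
  linear_arboricity (maxn k l) (strong_product G H)
    <= linear_arboricity k G + linear_arboricity l H
       + 2 * linear_arboricity k G * linear_arboricity l H.
Proof.
have [d1 [r1 [or1 cov1]]] := arboricity_linear_cover G k_gt0.
have [d2 [r2 [or2 cov2]]] := arboricity_linear_cover H l_gt0.
move: (linear_arboricity k G) (linear_arboricity l H) d1 r1 d2 r2 or1 or2 cov1 cov2.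
move=> a b d1 r1 d2 r2 or1 or2 cov1 cov2.
pose I : finType := ('I_a + 'I_b + bool * 'I_a * 'I_b)%type.
have -> : a + b + 2 * a * b = #|I|.
  by rewrite !card_sum !card_prod card_bool !card_ord.
(* The boolean [s] tells whether the second coordinate moves along [d2 j] or against it. *)
pose d (i : I) (p q : strong_product G H) : bool := match i with
  | inl (inl i) => d1 i p.1 q.1 && (p.2 == q.2)
  | inl (inr j) => (p.1 == q.1) && d2 j p.2 q.2
  | inr (s, i, j) => d1 i p.1 q.1 && if s then d2 j p.2 q.2 else d2 j q.2 p.2
  end.
(* Diagonal arrows always move along [d1 i], so the rank of the first coordinate serves for both
   values of [s]. *)
pose r (i : I) (p : strong_product G H) := match i with
  | inl (inl i) => r1 i p.1
  | inl (inr j) => r2 j p.2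
  | inr (_, i, _) => r1 i p.1
  end.
apply: (@linear_cover_arboricity _ I _ d r); first by rewrite leq_max k_gt0.
split.
  move=> [[i|j]|[[s i] j]]; split=> /=.
  - move=> [x1 x2] [y1 y2] [z1 z2] /= /andP[xy /eqP<-] /andP[xz /eqP<-].
    by rewrite (orient_fun (or1 i) xy xz).
  - move=> [x1 x2] [y1 y2] [z1 z2] /= /andP[xz /eqP->] /andP[yz /eqP->].
    by rewrite (orient_inj (or1 i) xz yz).
  - by move=> x y /andP[/(orient_step (or1 i))].
  - by move=> x; rewrite leq_max (orient_rank (or1 i)).
  - move=> [x1 x2] [y1 y2] [z1 z2] /= /andP[/eqP<- xy] /andP[/eqP<- xz].
    by rewrite (orient_fun (or2 j) xy xz).
  - move=> [x1 x2] [y1 y2] [z1 z2] /= /andP[/eqP-> xz] /andP[/eqP-> yz].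
    by rewrite (orient_inj (or2 j) xz yz).
  - by move=> x y /andP[_ /(orient_step (or2 j))].
  - by move=> x; rewrite leq_max (orient_rank (or2 j)) orbT.
  - move=> [x1 x2] [y1 y2] [z1 z2] /= /andP[xy xy'] /andP[xz xz'].
    rewrite (orient_fun (or1 i) xy xz); congr (_, _).
    (* Reversing [d2 j] exchanges functionality and injectivity. *)
    by case: s xy' xz'; [apply: orient_fun (or2 j) _ _ _|apply: orient_inj (or2 j) _ _ _].
  - move=> [x1 x2] [y1 y2] [z1 z2] /= /andP[xz xz'] /andP[yz yz'].
    rewrite (orient_inj (or1 i) xz yz); congr (_, _).
    by case: s xz' yz'; [apply: orient_inj (or2 j) _ _ _|apply: orient_fun (or2 j) _ _ _].
  - by move=> x y /andP[/(orient_step (or1 i))].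
  - by move=> x; rewrite leq_max (orient_rank (or1 i)).
move=> [x1 x2] [y1 y2]; rewrite /= /strong_adj /= => /or3P[] /andP[].
- move=> /cov1[i xy] /eqP->; exists (inl (inl i)).
  by rewrite /sym_closure /= !eqxx !andbT.
- move=> /eqP-> /cov2[j xy]; exists (inl (inr j)).
  by rewrite /sym_closure /= !eqxx.
(* Equal directions in both coordinates give [true], opposite ones [false]. *)
move=> /cov1[i /orP[]xy1] /cov2[j /orP[]xy2].
- by exists (inr (true, i, j)); rewrite /sym_closure /= xy1 xy2.
- by exists (inr (false, i, j)); rewrite /sym_closure /= xy1 xy2.
- by exists (inr (false, i, j)); rewrite /sym_closure /= xy1 xy2 orbT.
- by exists (inr (true, i, j)); rewrite /sym_closure /= xy1 xy2 orbT.
Qed.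

Lemma strong_product_arboricity_ge : 0 < #|G| -> 0 < #|H| ->
  uphalf (max_degree G * max_degree H + max_degree G + max_degree H)
    <= linear_arboricity (maxn k l) (strong_product G H).
Proof.
move=> G_gt0 H_gt0; rewrite leq_uphalf_double -mul2n.
apply: leq_trans (max_degree_strong_product G_gt0 H_gt0) _.
have kl_gt0 : 0 < maxn k l by rewrite leq_max k_gt0.
have [d [r dr]] := arboricity_linear_cover (strong_product G H) kl_gt0.
by have := linear_cover_max_degree dr; rewrite card_ord.
Qed.
End Product.

(** * Sharpness on the path with two edges *)

Section PathOfLengthTwo.

Definition path3_succ : rel 'I_3 := fun i j => i.+1 == j.

Fact path3_irr : irreflexive (sym_closure path3_succ).
Proof. by move=> i; rewrite /sym_closure /path3_succ orbb gtn_eqF. Qed.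

Definition path3 : sgraph := SGraph (sym_closure_sym path3_succ) path3_irr.

Lemma path3_arboricity : linear_arboricity 2 path3 <= 1.
Proof.
rewrite -[X in _ <= X]card_unit.
apply: (@linear_cover_arboricity 2 _ path3 (fun=> path3_succ) (fun=> val)) => //.
split=> [_|x y xy]; last by exists tt.
split=> [x y z|x y z|x y|x].
- by rewrite /path3_succ => /eqP xy /eqP xz; apply: val_inj; rewrite /= -xy.
- by rewrite /path3_succ => /eqP xz /eqP; rewrite -xz => -[/val_inj].
- by move/eqP => /= <-.
- exact: ltn_ord x.
Qed.

Lemma path3_max_degree : 2 <= max_degree path3.
Proof.
(* The middle vertex is adjacent to both ends. *)
pose u1 : path3 := inord 1.
apply: leq_trans (leq_bigmax u1).
have <- : #|[set ord0; ord_max : 'I_3]| = 2 by rewrite cards2.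
apply/subset_leq_card/subsetP=> i.
by rewrite !inE => /orP[]/eqP->; rewrite /= /sym_closure /path3_succ !inordK.
Qed.

(** This certifies that sharpness is not witnessed by edgeless graphs alone. *)
Lemma path3_edges : edges path3 != set0.
Proof.
apply/set0Pn; exists [set ord0; inord 1 : path3].
by rewrite mem_edges /= /sym_closure /path3_succ !inordK.
Qed.

(** From [2 <= n] and [a <= 1] the lower bound is at least 4 and the upper bound at most 4, which
    forces equality throughout without computing any arboricity exactly. *)
Lemma path3_sharp (n := max_degree path3) (a := linear_arboricity 2 path3) :
  uphalf (n * n + n + n) = linear_arboricity (maxn 2 2) (strong_product path3 path3)
  /\ linear_arboricity (maxn 2 2) (strong_product path3 path3) = a + a + 2 * a * a.
Proof.
have c3 : 0 < #|path3| by rewrite card_ord.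
have := @strong_product_arboricity_ge path3 path3 2 2 isT c3 c3.
have := @strong_product_arboricity path3 path3 2 2 isT isT.
rewrite -/n -/a; set b := linear_arboricity (maxn 2 2) _ => le_up le_low.
have up4 : a + a + 2 * a * a <= 4.
  by have := path3_arboricity; rewrite -/a; case: a {le_up} => [|[|]].
have low4 : 4 <= uphalf (n * n + n + n).
  rewrite -[4]/(uphalf (2 * 2 + 2 + 2)).
  have n2 := path3_max_degree; apply: uphalf_leq.
  by rewrite !leq_add ?leq_mul.
split; apply/eqP; rewrite eqn_leq.
- by rewrite le_low (leq_trans le_up) ?(leq_trans up4).
- by rewrite le_up (leq_trans up4) ?(leq_trans low4).
Qed.
End PathOfLengthTwo.

Theorem theorem2p11 :
  (forall (G H : sgraph) (k l : nat),
     0 < #|G| -> 0 < #|H| -> 0 < k -> 0 < l ->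
     uphalf (max_degree G * max_degree H + max_degree G + max_degree H)
       <= linear_arboricity (maxn k l) (strong_product G H)
       <= linear_arboricity k G + linear_arboricity l H
          + 2 * linear_arboricity k G * linear_arboricity l H)
  /\ (exists (G H : sgraph) (k l : nat),
        [/\ edges G != set0, edges H != set0, 0 < k, 0 < l &
            uphalf (max_degree G * max_degree H + max_degree G + max_degree H)
              = linear_arboricity (maxn k l) (strong_product G H)])
  /\ (exists (G H : sgraph) (k l : nat),
        [/\ edges G != set0, edges H != set0, 0 < k, 0 < l &
            linear_arboricity (maxn k l) (strong_product G H)
              = linear_arboricity k G + linear_arboricity l H
                + 2 * linear_arboricity k G * linear_arboricity l H]).
Proof.
split=> [G H k l G_gt0 H_gt0 k_gt0 l_gt0|].
  by rewrite strong_product_arboricity_ge // strong_product_arboricity.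
have [low up] := path3_sharp.
by split; exists path3, path3, 2, 2; split=> //; apply: path3_edges.
Qed.
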